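(* Consider the plant $$\dot x=Ax+Bu+B_ww,\qquad z=Cx+Du,$$ with $x(t)\in\mathbb{R}^n$, $u(t)\in\mathbb{R}^m$, $w(t)\in\mathbb{R}^{\bar m}$, $z(t)\in\mathbb{R}^k$ and real matrices $A,B,B_w,C,D$ of corresponding sizes, where $(A,B)$ is stabilizable, $(C,A)$ is observable, $C^\top D=0$ and $D^\top D$ is invertible. For $K\in\mathbb{R}^{m\times n}$ let $\mathcal{S}_K$ be the closed-loop system with $u=Kx$, input $w$ and output $z$, i.e. $\dot x=(A+BK)x+B_ww$, $z=(C+DK)x$. Let $\alpha>0$ and let $Q_\alpha\succ 0$ be the positive definite solution of $$Q_\alpha A+A^\top Q_\alpha+\alpha Q_\alpha-\alpha Q_\alpha B(D^\top D)^{-1}B^\top Q_\alpha+\frac1\alpha C^\top C=0.$$ Then the controller $u=Kx$ with $$K=-\alpha(D^\top D)^{-1}B^\top Q_\alpha$$ renders $\mathcal{S}_K$ stable (i.e. $A+BK$ is stable) and guarantees that its $\varepsilon(\alpha)$-norm possesses the smallest possible value (among all gain matrices in $\mathbb{R}^{m\times n}$ for which the $\varepsilon(\alpha)$-norm of the closed-loop system is defined), which is equal to $$\|\mathcal{S}_K\|_{\varepsilon(\alpha)}=\sqrt{\operatorname{trace}(B_w^\top Q_\alpha B_w)}.$$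
   Context: A matrix is stable if all its eigenvalues have strictly negative real parts. For a system $\mathcal{S}:\ \dot x=\mathcal{A}x+\mathcal{B}w,\ z=\mathcal{C}x$ with input $w$ and output $z$, and $\alpha>0$, the $\varepsilon(\alpha)$-norm is defined when $\mathcal{A}+\frac\alpha2 I$ is stable (equivalently $\alpha\in(0,-2r)$, $r<0$ the largest real part of the eigenvalues of $\mathcal{A}$), by $$\|\mathcal{S}\|_{\varepsilon(\alpha)}^2:=\operatorname{trace}(\mathcal{C}P\mathcal{C}^\top)=\operatorname{trace}(\mathcal{B}^\top Q\mathcal{B}),$$ where $P,Q$ are the unique solutions of $\mathcal{A}P+P\mathcal{A}^\top+\alpha P+\frac1\alpha\mathcal{B}\mathcal{B}^\top=0$ and $Q\mathcal{A}+\mathcal{A}^\top Q+\alpha Q+\frac1\alpha\mathcal{C}^\top\mathcal{C}=0$. *)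

(* Defs.v *)
(* Eigenvalues of real matrices are taken in the complex numbers [R[i]]. *)
From HB Require Import structures.
From mathcomp Require Import all_boot all_order all_algebra.
From mathcomp Require Import classical_sets reals.
From mathcomp Require Import complex.

Set Implicit Arguments.
Unset Strict Implicit.
Unset Printing Implicit Defensive.

Import Order.TTheory GRing.Theory Num.Theory.
Local Open Scope classical_set_scope.
Local Open Scope ring_scope.
Local Open Scope complex_scope.

Definition stable (R : realType) (n : nat) (A : 'M[R]_n) : Prop :=
  forall z : R[i], eigenvalue (map_mx (real_complex R) A) z -> complex.Re z < 0.

Definition stabilizable (R : realType) (n m : nat)
    (A : 'M[R]_n) (B : 'M[R]_(n, m)) : Prop :=
  exists F : 'M[R]_(m, n), stable (A + B *m F).

(* Kalman's rank condition: the stack of C, C A, ..., C A^(n-1) has rank n. *)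
Definition observable (R : realType) (n k : nat)
    (C : 'M[R]_(k, n)) (A : 'M[R]_n) : Prop :=
  \rank (\mxcol_(i < n) (C *m A ^+ i)) = n.

(* Positive definite matrices are symmetric by convention. *)
Definition posdef (R : realType) (n : nat) (Q : 'M[R]_n) : Prop :=
  Q^T = Q /\ forall x : 'cV[R]_n, x != 0 -> 0 < (x^T *m Q *m x) 0 0.

(* The system x' = A x + B w, z = C x, with n states, p inputs, k outputs. *)
Record lti (R : realType) (n p k : nat) := Lti {
  lti_A : 'M[R]_n;
  lti_B : 'M[R]_(n, p);
  lti_C : 'M[R]_(k, n)
}.

Definition lti_stable (R : realType) (n p k : nat) (S : lti R n p k) : Prop :=
  stable (lti_A S).

Definition closed_loop (R : realType) (n m p k : nat)
    (A : 'M[R]_n) (B : 'M[R]_(n, m)) (Bw : 'M[R]_(n, p))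
    (C : 'M[R]_(k, n)) (D : 'M[R]_(k, m)) (K : 'M[R]_(m, n)) : lti R n p k :=
  Lti (A + B *m K) Bw (C + D *m K).

Definition eps_defined (R : realType) (n p k : nat) (alpha : R)
    (S : lti R n p k) : Prop :=
  stable (lti_A S + (alpha / 2)%:M).

(* The solution P of A P + P A^T + alpha P + (1 / alpha) B B^T = 0.  It is
   unique when [eps_defined alpha S]; [xget 0] returns 0 if there is none. *)
Definition eps_gramian (R : realType) (n p k : nat) (alpha : R)
    (S : lti R n p k) : 'M[R]_n :=
  xget 0 [set P : 'M[R]_n |
    lti_A S *m P + P *m (lti_A S)^T + alpha *: P
      + alpha^-1 *: (lti_B S *m (lti_B S)^T) = 0].

(* Meaningful only under [0 < alpha] and [eps_defined alpha S]. *)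
Definition eps_norm (R : realType) (n p k : nat) (alpha : R)
    (S : lti R n p k) : R :=
  Num.sqrt (\tr (lti_C S *m eps_gramian alpha S *m (lti_C S)^T)).

(* Main.v *)
Require Import Defs.
From HB Require Import structures.
From mathcomp Require Import all_boot all_order all_algebra.
From mathcomp Require Import classical_sets reals.
From mathcomp Require Import complex.
From mathcomp Require Import ring.

Set Implicit Arguments.
Unset Strict Implicit.
Unset Printing Implicit Defensive.

Import Order.TTheory GRing.Theory Num.Theory.
Local Open Scope ring_scope.
Local Open Scope sesquilinear_scope.

(** The closed-loop cost of every admissible gain [L] splits as
<<
  tr(C_L P_L C_L^T) = tr(Bw^T Q Bw) + tr(D (L - K) P_L (L - K)^T D^T)
>>
    where [C_L = C + D L] and [P_L] is the Gramian of the loop closed by [L].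
    Since the Gramian is positive semidefinite, the last trace is nonnegative;
    it vanishes for [L = K].  The splitting has two ingredients.  Completing
    the square in the Riccati equation ([riccati_completed_square]) turns it
    into a Lyapunov equation for [A + B L] with an error term that is quadratic
    in [D (L - K)].  Pairing this equation with the one of [P_L] under the trace
    ([mxtrace_gramian_cost]) makes the terms in [A + B L] cancel, because the
    two Lyapunov operators are adjoint to each other.

    That [A + B K + alpha/2] is stable is the Lyapunov test
    ([lyapunov_stable]): the completed square for [L = K] reads
    [Q F + F^T Q + N^T N = 0] with [Q] positive definite, and an eigenvector
    in the kernel of [N] would be an unobservable mode of [(C, A)].

    What remains is the theory of the equation [F P + P F^* + H H^* = 0] for a
    stable [F]: it has a solution, and hermitian solutions are positive
    semidefinite.  The usual proof writes [P] as an integral of matrix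
    exponentials.  The proof given here is algebraic.  It rests on
    [quotient_eigenvector]: for every [P <> 0] there are an eigenvalue [z] of
    [F] and a row [v] with [v P <> 0] and [v F P = z v P], that is, an
    eigenvector modulo the left kernel of [P].  If [F P + P F^* = 0], such a
    [v] makes [- z^*] an eigenvalue of [F] as well, which stability forbids; so
    the Lyapunov operator is injective, hence bijective.  For positivity
    ([lyapunov_psd]) one step of Gaussian elimination along [v] lowers the rank
    of [P] and preserves the form of the equation. *)

(** * Eigenvectors modulo a left kernel *)

Lemma eigenvalue_tr (K : fieldType) n (F : 'M[K]_n) z :
  eigenvalue F^T z = eigenvalue F z.
Proof.
rewrite !eigenvalue_root_char /char_poly -[in RHS]det_tr; congr (root (\det _) z).
by rewrite /char_poly_mx linearB /= tr_scalar_mx map_trmx.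
Qed.

Lemma eigenvalue_shift (K : fieldType) n (F : 'M[K]_n) z a :
  eigenvalue F z -> eigenvalue (F + a%:M) (z + a).
Proof.
case/eigenvalueP => v vF v0; apply/eigenvalueP; exists v => //.
by rewrite mulmxDr vF mul_mx_scalar scalerDl.
Qed.

Lemma nz_row_mul (K : fieldType) n m (P : 'M[K]_(n, m)) :
  P != 0 -> exists v : 'rV_n, v *m P != 0.
Proof.
by move/rowV0Pn => [w /submxP [v ->] h]; exists v.
Qed.

(** By Cayley-Hamilton the product of the [F - z], for [z] ranging over the
    roots of the characteristic polynomial, annihilates [P].  Multiplying [P] by
    these factors one by one, the last nonzero product supplies a row [v] that
    the next factor annihilates.  The eigenvalue is one of [F] itself, not just
    of the map that [F] may induce on a quotient. *)
Lemma quotient_eigenvector (C : closedFieldType) n m (F : 'M[C]_n)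
    (P : 'M[C]_(n, m)) : P != 0 ->
  exists z (v : 'rV_n),
    [/\ eigenvalue F z, v *m P != 0 & v *m F *m P = z *: (v *m P)].
Proof.
case: n F P => [|n] F P P0; first by rewrite flatmx0 eqxx in P0.
suff claim (s : seq C) : {subset s <= eigenvalue F} -> forall P : 'M[C]_(_, m),
    P != 0 -> horner_mx F (\prod_(z <- s) ('X - z%:P)) *m P = 0 ->
    exists z (v : 'rV_n.+1),
    [/\ eigenvalue F z, v *m P != 0 & v *m F *m P = z *: (v *m P)].
  have [s Es] := closed_field_poly_normal (char_poly F).
  rewrite (monicP (char_poly_monic F)) scale1r in Es.
  apply: (claim s) => // [z zs|]; last by rewrite -Es Cayley_Hamilton mul0mx.
  by rewrite -topredE /= eigenvalue_root_char Es root_prod_XsubC.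
elim: s => [|z s IHs] sF {P0}P P0.
  by rewrite big_nil rmorph1 mul1mx => P0'; rewrite P0' eqxx in P0.
rewrite big_cons mulrC rmorphM /= -mulmxA rmorphB /= horner_mx_X horner_mx_C.
set P' := _ *m P; case: (eqVneq P' 0) => [FP0 _|P'0 sP'0].
  have [v vP] := nz_row_mul P0.
  exists z, v; split=> //; first by apply: sF; rewrite mem_head.
  move/(congr1 (mulmx v)): FP0; rewrite /P' mulmx0 mulmxBl mulmxBr mul_scalar_mx.
  by rewrite -scalemxAr mulmxA => /subr0_eq.
have sF' : {subset s <= eigenvalue F} by move=> y ys; apply: sF; rewrite in_cons ys orbT.
have [z' [v [ez' vP' vFP']]] := IHs sF' P' P'0 sP'0.
(* [v] works for [P' = (F - z) P], and [F - z] commutes with [F]. *)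
exists z', (v *m (F - z%:M)); rewrite -!mulmxA; split => //.
rewrite -[RHS]vFP' /P' !mulmxA; congr (_ *m _); rewrite -!mulmxA; congr (_ *m _).
by rewrite mulmxBl mulmxBr scalar_mxC.
Qed.

(** * The Lyapunov equation over the complex numbers *)

Section Lyapunov.
Variable C : numClosedFieldType.

(** The real part is written [z + z^*] (up to the factor 2), so that it stays in
    [C] and enters the computations without conversions. *)
Definition stableC n (F : 'M[C]_n) := forall z, eigenvalue F z -> z + z^* < 0.

(** Instances of the morphism laws: rewriting with the general ones replaces the
    notation [_^*] by the underlying bundled morphism, which blocks later
    rewriting. *)
Lemma conjN (t : C) : (- t)^* = - t^*. Proof. by rewrite rmorphN. Qed.
Lemma conjM (s t : C) : (s * t)^* = s^* * t^*. Proof. by rewrite rmorphM. Qed.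
Lemma conjV (t : C) : (t^-1)^* = (t^*)^-1. Proof. by rewrite fmorphV. Qed.

Lemma ctrmxM m n p (X : 'M[C]_(m, n)) (Y : 'M[C]_(n, p)) :
  (X *m Y)^t* = Y^t* *m X^t*.
Proof. by rewrite trmx_mul map_mxM. Qed.

Lemma ctrmxD m n (X Y : 'M[C]_(m, n)) : (X + Y)^t* = X^t* + Y^t*.
Proof. by rewrite linearD /= map_mxD. Qed.
Lemma ctrmxB m n (X Y : 'M[C]_(m, n)) : (X - Y)^t* = X^t* - Y^t*.
Proof. by rewrite linearB /= map_mxB. Qed.
Lemma ctrmxZ m n a (X : 'M[C]_(m, n)) : (a *: X)^t* = a^* *: X^t*.
Proof. by rewrite linearZ /= map_mxZ. Qed.
Lemma ctrmx1 n : (1%:M : 'M[C]_n)^t* = 1%:M.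
Proof. by rewrite trmx1 map_mx1. Qed.
Lemma ctrmx_scalar n (a : C) : (a%:M : 'M_n)^t* = (a^*)%:M.
Proof. by rewrite tr_scalar_mx map_scalar_mx. Qed.

Lemma gram_ge0 n (x : 'rV[C]_n) : 0 <= (x *m x^t*) 0 0.
Proof. by rewrite mxE; apply: sumr_ge0 => j _; rewrite !mxE mul_conjC_ge0. Qed.

Lemma gram_eq0 n (x : 'rV[C]_n) : (x *m x^t*) 0 0 = 0 -> x = 0.
Proof.
rewrite mxE => /eqP; rewrite psumr_eq0; last first.
  by move=> j _; rewrite !mxE mul_conjC_ge0.
move=> /allP h; apply/rowP => j; move: (h j (mem_index_enum _)).
by rewrite !mxE mul_conjC_eq0 => /eqP.
Qed.

(** Otherwise [- z] would be an eigenvalue of [F^*], and so [- z^*] one of [F];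
    but [z] and [- z^*] have opposite real parts. *)
Lemma stable_pencil n (F : 'M[C]_n) z (y : 'rV_n) :
  stableC F -> eigenvalue F z -> z *: y + y *m F^t* = 0 -> y = 0.
Proof.
move=> sF ez zy; apply/eqP/negP => /negP y0.
have eN : eigenvalue (F^t*) (- z).
  by apply/eigenvalueP; exists y => //; rewrite scaleNr; apply/eqP; rewrite -addr_eq0 addrC zy.
rewrite -[- z]conjCK eigenvalue_map eigenvalue_tr conjN in eN.
have := ltrD (sF _ ez) (sF _ eN).
by rewrite conjN conjCK [X in _ + X]addrC -opprD subrr addr0 ltxx.
Qed.

Lemma sylvester_inj n (F P : 'M[C]_n) :
  stableC F -> F *m P + P *m F^t* = 0 -> P = 0.
Proof.
move=> sF hP; apply/eqP/negP => /negP P0.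
have [z [v [ez vP0 vFP]]] := quotient_eigenvector F P0.
have : v *m P = 0.
  apply: (stable_pencil sF ez).
  by rewrite -vFP -!mulmxA -mulmxDr hP mulmx0.
by move=> h; rewrite h eqxx in vP0.
Qed.

(** Induction on the rank of [P].  Let [v] be an eigenvector of [F] modulo the
    left kernel of [P], with eigenvalue [z], and put [y = v P], [q = v P v^*].
    Evaluating the equation at [v] gives [2 Re z q = - |v H|^2], so [q >= 0].
    If [q = 0] then [v H = 0] and the equation reduces to [z y + y F^* = 0],
    which [stable_pencil] excludes.  So [q > 0], and the Schur complement
    [P' = P - y^* y / q] solves the equation with [E H] in place of [H], for
    [E = 1 - y^* v / q].  It has smaller rank as [v P' = 0], and [P] is
    [P'] plus a positive multiple of [y^* y]. *)
Lemma lyapunov_psd n p (F P : 'M[C]_n) (H : 'M[C]_(n, p)) :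
  stableC F -> P^t* = P -> F *m P + P *m F^t* + H *m H^t* = 0 ->
  forall x : 'rV_n, 0 <= (x *m P *m x^t*) 0 0.
Proof.
move=> sF; have [r] := ubnP (\rank P).
elim: r P H => // r IHr P H rP hP lyap x.
have [->|P0] := eqVneq P 0; first by rewrite mulmx0 mul0mx mxE.
have [z [v [ez]]] := quotient_eigenvector F P0.
set y := v *m P => y0 vFP.
have yE : P *m v^t* = y^t* by rewrite /y ctrmxM hP.
pose q := (y *m v^t*) 0 0.
have qE : y *m v^t* = q%:M by rewrite [LHS]mx11_scalar.
have q_real : q^* = q.
  have := congr1 (fun X => X^t*) qE; rewrite ctrmxM trmxCK -yE mulmxA -/y qE.
  by move/matrixP/(_ 0 0); rewrite !mxE eqxx !mulr1n => <-.
(* The equation multiplied by [v] on the left. *)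
have E1 : z *: y + y *m F^t* + v *m H *m H^t* = 0.
  by rewrite -vFP /y -!mulmxA -!mulmxDr lyap mulmx0.
pose g := (v *m H *m (v *m H)^t*) 0 0.
have gE : v *m H *m H^t* *m v^t* = g%:M.
  by rewrite [LHS]mx11_scalar /g ctrmxM mulmxA.
have qg : (z + z^*) * q = - g.
  have := congr1 (mulmx^~ (v^t*)) E1; rewrite /= !mulmxDl mul0mx -scalemxAl qE gE.
  have -> : y *m F^t* *m v^t* = (z^* * q)%:M.
    have <- : (v *m F *m P *m v^t*)^t* = y *m F^t* *m v^t*.
      by rewrite !ctrmxM trmxCK hP !mulmxA.
    by rewrite vFP -scalemxAl qE scale_scalar_mx ctrmx_scalar conjM q_real.
  move/matrixP/(_ 0 0); rewrite !mxE eqxx !mulr1n => h.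
  by apply/eqP; rewrite -addr_eq0 mulrDl h.
have g_ge0 : 0 <= g by apply: gram_ge0.
have q_neq0 : q != 0.
  apply: contraNneq y0 => q0; apply/eqP/(stable_pencil sF ez).
  have /gram_eq0 vH : g = 0 by apply: oppr_inj; rewrite -qg q0 mulr0 oppr0.
  by rewrite -[RHS]E1 vH mul0mx addr0.
have q_gt0 : 0 < q.
  rewrite lt0r q_neq0 -(nmulr_rle0 _ (sF _ ez)) qg oppr_le0 //.
pose E : 'M_n := 1%:M - q^-1 *: (y^t* *m v).
pose P' : 'M_n := P - q^-1 *: (y^t* *m y).
have qV : (q^-1)^* = q^-1 by rewrite conjV q_real.
have P'E : P' = E *m P by rewrite mulmxBl mul1mx -scalemxAl -mulmxA.
have P'v : P' *m v^t* = 0.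
  rewrite mulmxBl yE -scalemxAl -mulmxA qE mul_mx_scalar scalerA mulVf //.
  by rewrite scale1r subrr.
(* [v] is in the left kernel of [P'], but not in that of [P]. *)
have rP' : (\rank P' < r)%N.
  rewrite -ltnS; apply: leq_trans rP; rewrite ltnS; apply: rank_ltmx.
  rewrite ltmxE P'E submxMl /= -P'E; apply: contraNN y0 => /submxP [X PX].
  by rewrite -[y]trmxCK -yE PX -mulmxA P'v mulmx0 trmx0 map_mx0.
have hP' : P'^t* = P' by rewrite ctrmxB hP ctrmxZ ctrmxM trmxCK qV.
clearbody y.
have Fy : F *m y^t* = - (z^* *: y^t* + H *m H^t* *m v^t*).
  have := congr1 (fun X => X^t*) E1; rewrite /= !ctrmxD ctrmxZ !ctrmxM !trmxCK mulmxA.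
  rewrite trmx0 map_mx0 => h; apply/eqP; rewrite -addr_eq0 addrA.
  by rewrite [F *m _ + _]addrC h.
have yF : y *m F^t* = - (z *: y + v *m H *m H^t*).
  by apply/eqP; rewrite -addr_eq0 addrA [y *m _ + _]addrC E1.
have lyap' : F *m P' + P' *m F^t* + (E *m H) *m (E *m H)^t* = 0.
  pose G := H *m H^t*; pose X := y^t* *m y.
  pose U := y^t* *m (v *m G); pose V := G *m v^t* *m y.
  have FP' : F *m P' = F *m P + q^-1 *: (z^* *: X + V).
    by rewrite mulmxBr -scalemxAr mulmxA Fy mulNmx scalerN opprK mulmxDl -scalemxAl.
  have P'F : P' *m F^t* = P *m F^t* + q^-1 *: (z *: X + U).
    rewrite mulmxBl -scalemxAl -mulmxA yF mulmxN scalerN opprK mulmxDr -scalemxAr.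
    by rewrite -(mulmxA v).
  have EGE : E *m H *m (E *m H)^t* =
      G - q^-1 *: U - q^-1 *: V + (q^-1 * q^-1 * g) *: X.
    have EG : E *m G = G - q^-1 *: U by rewrite mulmxBl mul1mx -scalemxAl -mulmxA.
    have Et : E^t* = 1%:M - q^-1 *: (v^t* *m y) by rewrite ctrmxB ctrmx1 ctrmxZ ctrmxM trmxCK qV.
    rewrite ctrmxM mulmxA -(mulmxA E) -/G EG Et mulmxBr mulmx1 -scalemxAr mulmxBl mulmxA -/V.
    have UX : U *m (v^t* *m y) = g *: X.
      have -> : U *m (v^t* *m y) = y^t* *m (v *m H *m H^t* *m v^t*) *m y.
        by rewrite /U /G !mulmxA.
      by rewrite gE mul_mx_scalar -scalemxAl.
    rewrite -scalemxAl UX scalerBr opprB !scalerA addrCA addrC -!addrA.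
    by congr (_ + _); rewrite addrC.
  have {lyap}lyap : F *m P = - (P *m F^t* + G).
    by apply/eqP; rewrite -addr_eq0 addrA lyap.
  rewrite FP' P'F EGE lyap.
  have -> : g = - ((z + z^*) * q) by rewrite qg opprK.
  clearbody X U V G; move: (P *m _) => {FP' P'F EGE lyap} PF.
  by apply/matrixP => i j; rewrite !mxE; field; exact: q_neq0.
have -> : P = P' + q^-1 *: (y^t* *m y) by rewrite subrK.
rewrite mulmxDr mulmxDl mxE addr_ge0 //; first exact: IHr lyap' _.
rewrite -scalemxAr -scalemxAl mxE mulr_ge0 ?invr_ge0 ?(ltW q_gt0) //.
suff -> : x *m (y^t* *m y) *m x^t* = (x *m y^t*) *m (x *m y^t*)^t*.
  exact: gram_ge0.
by rewrite ctrmxM trmxCK !mulmxA.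
Qed.
End Lyapunov.

(** * The Lyapunov equation over the real numbers *)

Section RealLyapunov.
Variable R : realType.
Local Notation cx := (map_mx (real_complex R)).

Lemma ctrmx_real m n (X : 'M[R]_(m, n)) : (cx X)^t* = cx X^T.
Proof.
apply/matrixP => i j; rewrite !mxE; apply: conj_Creal; by rewrite complex_real.
Qed.

Lemma stable_complex n (F : 'M[R]_n) : stable F -> stableC (cx F).
Proof.
move=> sF z /sF rz; rewrite (addcJ z) pmulr_rlt0 ?ltr0n // ltcR; exact: rz.
Qed.

Lemma real_sylvester_inj n (F P : 'M[R]_n) :
  stable F -> F *m P + P *m F^T = 0 -> P = 0.
Proof.
move=> sF hP; apply: (map_mx_inj (f := real_complex R)); rewrite /= map_mx0.
apply: (sylvester_inj (stable_complex sF)).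
by rewrite ctrmx_real -!map_mxM -map_mxD hP map_mx0.
Qed.

(** An injective endomorphism of a space of finite dimension is onto. *)
Lemma real_lyapunov_ex n (F G : 'M[R]_n) :
  stable F -> exists P, F *m P + P *m F^T + G = 0.
Proof.
move=> sF.
pose T (P : 'M[R]_n) := F *m P + P *m F^T.
have linT : linear T.
  move=> a X Y; rewrite /T mulmxDr mulmxDl -scalemxAr -scalemxAl scalerDr.
  by rewrite addrACA.
pose Tl := GRing.isLinear.Build _ _ _ _ T linT.
pose f : {linear 'M[R]_n -> 'M[R]_n} := HB.pack T Tl.
have uf : lin_mx f \in unitmx.
  rewrite -row_free_unit -kermx_eq0; apply/rowV0P => v /sub_kermxP.
  rewrite -[v]vec_mxK mul_vec_lin => /(canRL mxvecK).
  by rewrite linear0 => /(real_sylvester_inj sF) ->; rewrite linear0.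
exists (vec_mx (mxvec (- G) *m invmx (lin_mx f))).
apply/eqP; rewrite addr_eq0; apply/eqP; apply: (can_inj mxvecK).
by rewrite -[LHS](mul_vec_lin f) vec_mxK mulmxKV.
Qed.

Lemma real_lyapunov_psd n p (F P : 'M[R]_n) (H : 'M[R]_(n, p)) :
  stable F -> P^T = P -> F *m P + P *m F^T + H *m H^T = 0 ->
  forall x : 'rV_n, 0 <= (x *m P *m x^T) 0 0.
Proof.
move=> sF sP hP x.
have := @lyapunov_psd _ _ _ (cx F) (cx P) (cx H) (stable_complex sF) _ _ (cx x).
rewrite !ctrmx_real sP -!map_mxM -!map_mxD hP map_mx0 mxE ler0c.
by apply.
Qed.

(** For [u = a + i b] the cross terms [b Q a^T] and [a Q b^T] cancel since [Q]
    is symmetric. *)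
Lemma posdef_complex n (Q : 'M[R]_n) (u : 'rV[R[i]]_n) :
  posdef Q -> u != 0 -> 0 < (u *m cx Q *m u^t*) 0 0.
Proof.
move=> [sQ pQ] u0.
pose a := map_mx (@complex.Re R) u; pose b := map_mx (@complex.Im R) u.
have uE : u = cx a + 'i%C *: cx b by apply/rowP => j; rewrite !mxE -complexE.
have pos (x : 'rV_n) : x != 0 -> 0 < (x *m Q *m x^T) 0 0.
  by move=> x0; have := pQ x^T; rewrite trmx_eq0 trmxK; apply.
have nneg (x : 'rV_n) : 0 <= (x *m Q *m x^T) 0 0.
  by have [->|/pos/ltW//] := eqVneq x 0; rewrite !mul0mx mxE.
have -> : u *m cx Q *m u^t* = cx (a *m Q *m a^T + b *m Q *m b^T).
  have ci : ('i%C : R[i])^* = - 'i%C by apply/eqP; rewrite eq_complex /= oppr0 !eqxx.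
  have cross : b *m Q *m a^T = a *m Q *m b^T.
    have -> : b *m Q *m a^T = (a *m Q *m b^T)^T by rewrite !trmx_mul trmxK sQ mulmxA.
    by apply/matrixP => i j; rewrite mxE !ord1.
  rewrite uE ctrmxD ctrmxZ !ctrmx_real ci mulmxDl mulmxDr !mulmxDl.
  rewrite -!scalemxAl -!scalemxAr -!map_mxM cross scalerA mulrN.
  have -> : ('i%C * 'i%C : R[i]) = -1 by rewrite -expr2 sqr_i.
  by rewrite opprK scale1r scaleNr addrA addrK map_mxD.
rewrite mxE ltcR mxE.
have [a0|/pos a_gt0] := eqVneq a 0; last exact: ltr_wpDr.
have [b0|/pos b_gt0] := eqVneq b 0; last exact: ltr_wpDl.
by rewrite uE a0 b0 !map_mx0 scaler0 addr0 eqxx in u0.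
Qed.

(** * Lyapunov's stability test and observability *)

(** The eigenvalues of [F] are read on rows [u] with [u F^T = z u], the
    conjugate transposes of right eigenvectors.  At such a [u] the equation
    says [2 Re z (u Q u^* ) = - |u N^T|^2]. *)
Lemma lyapunov_stable n p (F Q : 'M[R]_n) (N : 'M[R]_(p, n)) :
  posdef Q -> Q *m F + F^T *m Q + N^T *m N = 0 ->
  (forall z (u : 'rV_n), u *m cx F^T = z *: u -> u *m cx N^T = 0 -> u = 0) ->
  stable F.
Proof.
move=> pQ lyap obs z; rewrite -eigenvalue_tr map_trmx => /eigenvalueP [u uF u0].
pose s := (u *m cx Q *m u^t*) 0 0.
have s0 : 0 < s by apply: posdef_complex.
pose w := u *m cx N^T.
have main : (z + z^*) * s = - (w *m w^t*) 0 0.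
  have := congr1 (fun X => (u *m cx X *m u^t*) 0 0) lyap.
  rewrite map_mx0 mulmx0 mul0mx [in RHS]mxE !map_mxD !map_mxM.
  have Fu : cx F *m u^t* = z^* *: u^t*.
    by have := congr1 (fun X => X^t*) uF; rewrite ctrmxM ctrmx_real trmxK ctrmxZ.
  have -> : u *m (cx Q *m cx F + cx F^T *m cx Q + cx N^T *m cx N) *m u^t* =
      (z + z^*) *: (u *m cx Q *m u^t*) + w *m w^t*.
    rewrite !mulmxDr !mulmxDl /w ctrmxM ctrmx_real trmxK !mulmxA uF.
    by rewrite -(mulmxA _ (cx F)) Fu -scalemxAr -!scalemxAl scalerDl [_ *: _ + z *: _]addrC.
  by rewrite mxE [X in X + _]mxE => h; apply/eqP; rewrite -addr_eq0 h.
have w0 : 0 < (w *m w^t*) 0 0.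
  rewrite lt0r gram_ge0 andbT; apply: contraNneq u0 => /gram_eq0 w0.
  by apply/eqP; exact: obs uF w0.
have : z + z^* < 0 by rewrite -(pmulr_llt0 _ s0) main oppr_lt0.
by rewrite (addcJ z) pmulr_rlt0 ?ltr0n // ltcR.
Qed.

(** The Popov-Belevitch-Hautus direction of Kalman's criterion: [u (A^i)^T C^T] is
    [z^i u C^T = 0] for every [i], so [u] is killed by the observability matrix. *)
Lemma observable_eigenvector n k (C : 'M[R]_(k, n)) (A : 'M[R]_n) z (u : 'rV_n) :
  observable C A -> u *m cx A^T = z *: u -> u *m cx C^T = 0 -> u = 0.
Proof.
rewrite /observable; set O := \mxcol_i _ => rO uA uC.
have uAi i : u *m cx (A ^+ i)^T = z ^+ i *: u.
  elim: i => [|i IHi]; first by rewrite expr0 trmx1 map_mx1 mulmx1 scale1r.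
  by rewrite exprS trmx_mul map_mxM mulmxA IHi -scalemxAl uA scalerA exprSr.
have OT : u *m cx O^T = 0.
  apply: trmx_inj; rewrite trmx_mul map_trmx trmxK trmx0.
  have -> : cx O = \mxcol_(i < n) cx (C *m A ^+ i).
    by apply/matrixP => i j; rewrite !mxE.
  rewrite mxcol_mul -[RHS]mxcol0; apply: eq_mxcol => i.
  apply: trmx_inj; rewrite trmx_mul trmxK map_trmx trmx_mul map_mxM mulmxA uAi.
  by rewrite -scalemxAl uC scaler0 trmx0.
have fO : row_free (cx O^T) by rewrite row_free_map /row_free mxrank_tr rO.
by apply: (row_free_inj fO); rewrite mul0mx.
Qed.

(** The term [alpha P] is absorbed by shifting [A] by [alpha/2], which is why
    the norm is tied to the stability of the shifted matrix. *)
Lemma lyapunov_shift n alpha (A P G : 'M[R]_n) :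
  A *m P + P *m A^T + alpha *: P + G =
  (A + (alpha / 2)%:M) *m P + P *m (A + (alpha / 2)%:M)^T + G.
Proof.
rewrite linearD /= tr_scalar_mx mulmxDl mulmxDr mul_scalar_mx mul_mx_scalar.
by rewrite addrACA -scalerDl -splitr.
Qed.

Lemma mulmx_sqrt_scale alpha m n q (X : 'M[R]_(m, n)) (Y : 'M[R]_(n, q)) :
  0 < alpha ->
  ((Num.sqrt alpha)^-1 *: X) *m ((Num.sqrt alpha)^-1 *: Y) = alpha^-1 *: (X *m Y).
Proof.
move=> alpha_gt0.
by rewrite -scalemxAl -scalemxAr scalerA -invfM -expr2 sqr_sqrtr ?ltW.
Qed.

Lemma lyapunov_shift_stable n p alpha (A Q : 'M[R]_n) (N : 'M[R]_(p, n)) :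
  0 < alpha -> posdef Q ->
  Q *m A + A^T *m Q + alpha *: Q + alpha^-1 *: (N^T *m N) = 0 ->
  (forall z (u : 'rV_n), u *m cx A^T = z *: u -> u *m cx N^T = 0 -> u = 0) ->
  stable (A + (alpha / 2)%:M).
Proof.
move=> alpha_gt0 pQ lyap obs.
apply: (lyapunov_stable (N := (Num.sqrt alpha)^-1 *: N) pQ) => [|z u uF uN].
  rewrite [(_ *: N)^T]linearZ /= mulmx_sqrt_scale // -lyap [Q *m A + _]addrC.
  have := lyapunov_shift alpha A^T Q (alpha^-1 *: (N^T *m N)).
  rewrite trmxK => ->; rewrite [_ *m Q + _]addrC.
  have <- : (A + (alpha / 2)%:M)^T = A^T + (alpha / 2)%:M.
    by rewrite [LHS]linearD /= tr_scalar_mx.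
  by rewrite trmxK.
apply: (obs (z - (alpha / 2)%:C%C)).
  move/eqP: uF; rewrite [(A + _)^T]linearD /= tr_scalar_mx map_mxD map_scalar_mx.
  rewrite mulmxDr mul_mx_scalar -subr_eq0 -addrA -scalerBl addr_eq0 -scaleNr opprB.
  by move=> /eqP uA; exact: uA.
apply/eqP; move/eqP: uN; rewrite linearZ /= map_mxZ -scalemxAr scaler_eq0.
by rewrite fmorph_eq0 invr_eq0 sqrtr_eq0 leNgt alpha_gt0.
Qed.

(** As [C^T D = 0], the equation [u (C + D K)^T = 0] multiplied by [D] leaves
    [u K^T D^T D = 0]: the feedback vanishes on [u], which is then an
    unobservable mode of the open loop. *)
Lemma observable_closed_loop n m k (A : 'M[R]_n) (B : 'M[R]_(n, m))
    (C : 'M[R]_(k, n)) (D : 'M[R]_(k, m)) (K : 'M[R]_(m, n)) z (u : 'rV_n) :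
  observable C A -> C^T *m D = 0 -> D^T *m D \in unitmx ->
  u *m cx (A + B *m K)^T = z *: u -> u *m cx (C + D *m K)^T = 0 -> u = 0.
Proof.
move=> oCA CD uD uA uC.
have uK : u *m cx K^T = 0.
  have CKD : (C + D *m K)^T *m D = K^T *m (D^T *m D).
    by rewrite linearD /= mulmxDl CD add0r trmx_mul mulmxA.
  by rewrite -[K^T](mulmxK uD) -CKD 2!map_mxM !mulmxA uC !mul0mx.
apply: (observable_eigenvector (z := z) oCA).
  rewrite linearD /= trmx_mul map_mxD map_mxM mulmxDr mulmxA uK in uA.
  by rewrite mul0mx addr0 in uA.
rewrite linearD /= trmx_mul map_mxD map_mxM mulmxDr mulmxA uK in uC.
by rewrite mul0mx addr0 in uC.
Qed.

Lemma stable_unshift n (A : 'M[R]_n) a : 0 <= a -> stable (A + a%:M) -> stable A.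
Proof.
move=> a0 sA z ez.
have := sA (z + a%:C%C); rewrite map_mxD map_scalar_mx => /(_ (eigenvalue_shift _ ez)).
by rewrite raddfD /=; apply: le_lt_trans; rewrite lerDl.
Qed.

End RealLyapunov.

(** * The Gramian *)

Section Gramian.
Variables (R : realType) (n p k : nat) (alpha : R) (S : lti R n p k).
Hypotheses (alpha_gt0 : 0 < alpha) (S_def : eps_defined alpha S).

Lemma eps_gramianP :
  lti_A S *m eps_gramian alpha S + eps_gramian alpha S *m (lti_A S)^T
    + alpha *: eps_gramian alpha S + alpha^-1 *: (lti_B S *m (lti_B S)^T) = 0.
Proof.
have [P hP] := real_lyapunov_ex (alpha^-1 *: (lti_B S *m (lti_B S)^T)) S_def.
rewrite -lyapunov_shift in hP.
exact: (@xgetPex _ 0 [set P | _]%classic (ex_intro _ P hP)).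
Qed.

(** The trace only sees the symmetric part of the Gramian, which solves the same
    equation because the source term is symmetric; so [real_lyapunov_psd]
    applies to it. *)
Lemma mxtrace_eps_gramian_ge0 q (Z : 'M[R]_(q, n)) :
  0 <= \tr (Z *m eps_gramian alpha S *m Z^T).
Proof.
set P := eps_gramian alpha S; pose P' := 2^-1 *: (P + P^T).
have -> : \tr (Z *m P *m Z^T) = \tr (Z *m P' *m Z^T).
  rewrite /P' -scalemxAr -scalemxAl mxtraceZ mulmxDr mulmxDl mxtraceD.
  have -> : \tr (Z *m P^T *m Z^T) = \tr (Z *m P *m Z^T).
    by rewrite -mxtrace_tr !trmx_mul !trmxK mulmxA.
  by move: (\tr _) => t; field.
have psd (x : 'rV_n) : 0 <= (x *m P' *m x^T) 0 0.
  apply: (real_lyapunov_psd (H := (Num.sqrt alpha)^-1 *: lti_B S) S_def).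
    by rewrite /P' linearZ /= linearD /= trmxK addrC.
  rewrite [(_ *: lti_B S)^T]linearZ /= mulmx_sqrt_scale //.
  rewrite -lyapunov_shift; set A := lti_A S; set G := alpha^-1 *: _.
  have hP : A *m P + P *m A^T + alpha *: P + G = 0 by exact: eps_gramianP.
  have hPT : A *m P^T + P^T *m A^T + alpha *: P^T + G = 0.
    have := congr1 trmx hP; rewrite !linearD !linearZ /= !trmx_mul !trmxK trmx0.
    by rewrite [P^T *m _ + _]addrC.
  transitivity (2^-1 *: ((A *m P + P *m A^T + alpha *: P + G) +
                         (A *m P^T + P^T *m A^T + alpha *: P^T + G))).
    clearbody G; rewrite /P' -scalemxAr -scalemxAl mulmxDl mulmxDr.
    move: (A *m P) (P *m A^T) (A *m P^T) (P^T *m A^T) => X1 X2 X3 X4.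
    by apply/matrixP => i j; rewrite !mxE; field.
  by rewrite hP hPT addr0 scaler0.
apply: sumr_ge0 => i _.
suff -> : (Z *m P' *m Z^T) i i = (row i Z *m P' *m (row i Z)^T) 0 0 by [].
rewrite tr_row -row_mul [LHS]mxE [RHS]mxE; apply: eq_bigr => j _.
by rewrite [row _ _ _ _]mxE [col _ _ _ _]mxE.
Qed.
End Gramian.

(** * The cost of a gain *)

(** Traces of the equation of [P] multiplied by [Q] and of the equation of [Q]
    multiplied by [P]: both contain [tr(Q A P)], [tr(Q P A^T)] and
    [alpha tr(Q P)], which drop out of the difference. *)
Lemma mxtrace_gramian_cost (F : fieldType) n p k q (alpha : F)
    (A P Q : 'M[F]_n) (B : 'M[F]_(n, p)) (C : 'M[F]_(k, n)) (Z : 'M[F]_(q, n)) :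
  alpha != 0 ->
  A *m P + P *m A^T + alpha *: P + alpha^-1 *: (B *m B^T) = 0 ->
  Q *m A + A^T *m Q + alpha *: Q + alpha^-1 *: (C^T *m C) = alpha^-1 *: (Z^T *m Z) ->
  \tr (C *m P *m C^T) = \tr (B^T *m Q *m B) + \tr (Z *m P *m Z^T).
Proof.
move=> a0 hP hQ.
have tP : \tr (Q *m A *m P) + \tr (Q *m P *m A^T) + alpha * \tr (Q *m P) +
   alpha^-1 * \tr (B^T *m Q *m B) = 0.
  have := congr1 (fun X => \tr (Q *m X)) hP.
  rewrite mulmx0 mxtrace0 !mulmxDr !mxtraceD -!scalemxAr !mxtraceZ !mulmxA.
  by rewrite -(mulmxA _ Q) [\tr (B^T *m _)]mxtrace_mulC.
have tQ : \tr (Q *m A *m P) + \tr (Q *m P *m A^T) + alpha * \tr (Q *m P) +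
   alpha^-1 * \tr (C *m P *m C^T) = alpha^-1 * \tr (Z *m P *m Z^T).
  have := congr1 (fun X => \tr (X *m P)) hQ.
  rewrite !mulmxDl !mxtraceD -!scalemxAl !mxtraceZ.
  rewrite -(mulmxA A^T) (mxtrace_mulC A^T) -(mulmxA C^T) (mxtrace_mulC C^T).
  by rewrite -(mulmxA Z^T) (mxtrace_mulC Z^T).
have := congr2 (fun x y => alpha * (x - y)) tQ tP => /=.
rewrite [RHS]mulrBr mulr0 subr0 mulVKf //.
have -> : forall a b c : F, alpha * (a + alpha^-1 * b - (a + alpha^-1 * c)) = b - c.
  by move=> a b c; field.
by move=> <-; rewrite addrCA subrr addr0.
Qed.

(** With [M = D^T D], the choice of [K] means [B^T Q = - alpha^-1 M K], so the
    terms of the closed loop that involve [L] are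
    [alpha^-1 (L^T M L - L^T M K - K^T M L)], and the quadratic term of the
    Riccati equation supplies the missing [alpha^-1 K^T M K]. *)
Lemma riccati_completed_square (F : fieldType) (n m k : nat)
    (A : 'M[F]_n) (B : 'M[F]_(n, m)) (C : 'M[F]_(k, n)) (D : 'M[F]_(k, m))
    (alpha : F) (Q : 'M[F]_n) (K L : 'M[F]_(m, n)) :
  C^T *m D = 0 -> D^T *m D \in unitmx -> alpha != 0 -> Q^T = Q ->
  Q *m A + A^T *m Q + alpha *: Q
    - alpha *: (Q *m B *m invmx (D^T *m D) *m B^T *m Q)
    + alpha^-1 *: (C^T *m C) = 0 ->
  K = - alpha *: (invmx (D^T *m D) *m B^T *m Q) ->
  Q *m (A + B *m L) + (A + B *m L)^T *m Q + alpha *: Q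
    + alpha^-1 *: ((C + D *m L)^T *m (C + D *m L)) =
  alpha^-1 *: ((D *m (L - K))^T *m (D *m (L - K))).
Proof.
move=> CD uM a0 sQ hQ hK.
(* An opaque name for [D^T D] keeps associativity rewriting out of it. *)
have [M ME] : {M | M = D^T *m D} by exists (D^T *m D).
rewrite -ME in uM hQ hK.
have sM : M^T = M by rewrite ME trmx_mul trmxK.
have DC : D^T *m C = 0 by apply: trmx_inj; rewrite trmx_mul trmxK CD trmx0.
have BQ : B^T *m Q = - alpha^-1 *: (M *m K).
  rewrite hK -scalemxAr scalerA -!mulmxA mulKVmx //.
  by rewrite mulrNN mulVf // scale1r.
have QB : Q *m B = - alpha^-1 *: (K^T *m M).
  by have := congr1 trmx BQ; rewrite linearZ /= !trmx_mul trmxK sQ sM.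
have -> : (C + D *m L)^T *m (C + D *m L) = C^T *m C + L^T *m M *m L.
  rewrite ME [(C + _)^T]linearD /= trmx_mul mulmxDl !mulmxDr -!mulmxA DC mulmx0 mulmxA CD.
  by rewrite mul0mx addr0 add0r !mulmxA.
have -> : (D *m (L - K))^T *m (D *m (L - K)) =
    L^T *m M *m L - L^T *m M *m K - K^T *m M *m L + K^T *m M *m K.
  rewrite ME trmx_mul -!(mulmxA _ D^T) !mulmxA [(L - K)^T]linearB /=.
  rewrite !(mulmxBl, mulmxBr).
  by rewrite opprB addrA [LHS]addrAC; congr (_ + _); apply: addrAC.
rewrite -(mulmxA _ B^T) BQ QB in hQ.
rewrite mulmxDr [(A + _)^T]linearD /= mulmxDl trmx_mul -(mulmxA _ B^T) BQ (mulmxA Q B) QB.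
rewrite -!scalemxAl -!scalemxAr !mulmxA.
rewrite -!scalemxAl -!scalemxAr !scalerA mulmxA mulmxK // in hQ.
apply: subr0_eq; rewrite -[RHS]hQ.
move: (Q *m A) (A^T *m Q) (C^T *m C) => X1 X2 X3.
move: (L^T *m M *m L) (L^T *m M *m K) (K^T *m M *m L) (K^T *m M *m K).
by move=> Y1 Y2 Y3 Y4; apply/matrixP => i j; rewrite !mxE; field; exact: a0.
Qed.

Theorem theorem6 (R : realType) (n m p k : nat)
    (A : 'M[R]_n) (B : 'M[R]_(n, m)) (Bw : 'M[R]_(n, p))
    (C : 'M[R]_(k, n)) (D : 'M[R]_(k, m))
    (hAB : stabilizable A B) (hCA : observable C A)
    (hCD : C^T *m D = 0) (hD : D^T *m D \in unitmx)
    (alpha : R) (halpha : 0 < alpha)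
    (Q : 'M[R]_n) (hQpos : posdef Q)
    (hQ : Q *m A + A^T *m Q + alpha *: Q
          - alpha *: (Q *m B *m invmx (D^T *m D) *m B^T *m Q)
          + alpha^-1 *: (C^T *m C) = 0)
    (K : 'M[R]_(m, n)) (hK : K = - alpha *: (invmx (D^T *m D) *m B^T *m Q)) :
  let S := closed_loop A B Bw C D in
  [/\ lti_stable (S K),
      eps_defined alpha (S K),
      forall L : 'M[R]_(m, n), eps_defined alpha (S L) ->
        eps_norm alpha (S K) <= eps_norm alpha (S L)
    & eps_norm alpha (S K) = Num.sqrt (\tr (Bw^T *m Q *m Bw))].
Proof.
move=> S.
have a0 : alpha != 0 by rewrite gt_eqF.
have square L := riccati_completed_square L hCD hD a0 (proj1 hQpos) hQ hK.
have cost L : eps_defined alpha (S L) ->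
    \tr (lti_C (S L) *m eps_gramian alpha (S L) *m (lti_C (S L))^T) =
    \tr (Bw^T *m Q *m Bw) +
    \tr (D *m (L - K) *m eps_gramian alpha (S L) *m (D *m (L - K))^T).
  by move=> SL; apply: mxtrace_gramian_cost a0 (eps_gramianP SL) (square L).
have defK : eps_defined alpha (S K).
  have := square K; rewrite subrr mulmx0 trmx0 mul0mx scaler0 => lyapK.
  apply: (lyapunov_shift_stable halpha hQpos lyapK) => z u.
  exact: observable_closed_loop hCA hCD hD.
have costK : eps_norm alpha (S K) = Num.sqrt (\tr (Bw^T *m Q *m Bw)).
  by rewrite /eps_norm cost // subrr mulmx0 !mul0mx mxtrace0 addr0.
split; [|exact: defK| |exact: costK].
  have half_ge0 : 0 <= alpha / 2 by rewrite divr_ge0 ?ltW.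
  exact: stable_unshift half_ge0 defK.
move=> L defL; rewrite costK /eps_norm (cost L defL) ler_wsqrtr // lerDl.
exact: mxtrace_eps_gramian_ge0.
Qed.
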